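(* Let $R$ be a commutative Noetherian ring, $N$ a non-zero finitely generated $R$-module, and $I$ an ideal of $R$ with $N/IN\neq 0$ such that the $\mathfrak{p}$-symbolic topology on $N$ is equivalent to the $\mathfrak{p}$-adic topology on $N$ for all $\mathfrak{p}\in \operatorname{mAss}_R N/IN$. Then the $I$-symbolic topology on $N$ is equivalent to the $I$-adic topology on $N$.
   Context: For an $R$-module $L$, $\operatorname{mAss}_R L$ denotes the set of minimal elements (with respect to inclusion) of $\operatorname{Ass}_R L$. For an ideal $I$ of $R$ and a natural number $n$, the $n$th symbolic power of $I$ with respect to $N$ is $$(IN)^{(n)}=\{x\in N : sx\in I^nN \text{ for some } s\in R\setminus\textstyle\bigcup_{\mathfrak{p}\in \operatorname{mAss}_R N/IN}\mathfrak{p}\},$$ equivalently the intersection of those primary components of $I^nN$ which correspond to the minimal primes of $\operatorname{Ass}_R N/IN$. The $I$-adic topology on $N$ is induced by the filtration $\{I^nN\}_{n\ge 0}$ and the $I$-symbolic topology on $N$ by the filtration $\{(IN)^{(n)}\}_{n\ge 0}$. One always has $I^nN\subseteq (IN)^{(n)}$; the two topologies are said to be equivalent if for every natural number $n$ there is a natural number $m$ such that $(IN)^{(m)}\subseteq I^nN$. *)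

(* Defs.v *)
From HB Require Import structures.
From mathcomp Require Import all_boot all_algebra.
From mathcomp Require Import boolp classical_sets.

Set Implicit Arguments.
Unset Strict Implicit.
Unset Printing Implicit Defensive.

Import GRing.Theory.

Local Open Scope ring_scope.
Local Open Scope quotient_scope.
Local Open Scope classical_set_scope.

(* Conventions: sets of elements are boolean (collective) predicates, which is
   no restriction because membership is classically decidable.  An ideal of R
   is a submodule of the regular module R^o (so R itself is an ideal); prime
   ideals are those of ring_quotient.  The operations below take arbitrary
   predicates, so that they apply to both kinds of ideals. *)

Section Submodules.
Variables (R : comNzRingType) (V : lmodType R).

Definition mspan (A : set V) : {pred V} :=
  [in smallest (fun K : set V => GRing.submod_closed [in K]) A].

Lemma mspan_submod_closed (A : set V) : GRing.submod_closed (mspan A).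
Proof.
split=> [|a u v]; rewrite !inE /=.
  by move=> K /= [[K0 _] _]; have := K0; rewrite !inE.
move=> Ku Kv K /= KA; have [[_ Klin] _] := KA.
have /(_ u v) := Klin a; rewrite !inE; apply; [exact: Ku | exact: Kv].
Qed.

HB.instance Definition _ (A : set V) :=
  GRing.isSubmodClosed.Build R V (mspan A) (mspan_submod_closed A).

Definition finitely_generated (K : {pred V}) : Prop :=
  exists s : seq V, mspan [set` s] =i K.

(* I K, the submodule generated by the products a x with a in I, x in K *)
Definition smul (I : {pred R}) (K : {pred V}) : {pred V} :=
  mspan [set a *: x | a in [set` I] & x in [set` K]].

HB.instance Definition _ (I : {pred R}) (K : {pred V}) :=
  GRing.SubmodClosed.on (smul I K).
End Submodules.


Section QuotientModule.
Variables (R : comNzRingType) (V : lmodType R) (K : submodClosed V).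

(* A copy of K: submodClosed does not record the closure under opposite that
   Quotient.quot requires. *)
Definition submod_pred : {pred V} := K.

HB.instance Definition _ :=
  GRing.isSubmodClosed.Build R V submod_pred (GRing.submodClosedP K).

Definition mquot : Type := Quotient.quot submod_pred.

HB.instance Definition _ := GRing.Zmodule.on mquot.

Definition mquot_pi (x : V) : mquot := \pi_(Quotient.quot submod_pred) x.

Definition mquot_scale (a : R) (u : mquot) : mquot := mquot_pi (a *: repr u).

Lemma mquot_scale_pi (a : R) (x : V) :
  mquot_scale a (mquot_pi x) = mquot_pi (a *: x).
Proof.
apply/eqP; rewrite -Quotient.idealrBE -scalerBr rpredZ //.
by rewrite Quotient.idealrBE reprK.
Qed.

Lemma mquot_pi_repr (u : mquot) : mquot_pi (repr u) = u.
Proof. exact: reprK. Qed.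

Lemma mquot_piD : {morph mquot_pi : x y / x + y}.
Proof. by move=> x y; rewrite /mquot_pi !piE. Qed.

Lemma mquot_pi_eq0 (x : V) : (mquot_pi x == 0) = (x \in K).
Proof.
have := Quotient.idealrBE submod_pred x 0; rewrite subr0 => xK.
rewrite [RHS]xK; congr (_ == _).
by apply: (addrI (mquot_pi 0)); rewrite addr0 -mquot_piD addr0.
Qed.

Fact mquot_scalerA (a b : R) (u : mquot) :
  mquot_scale a (mquot_scale b u) = mquot_scale (a * b) u.
Proof. by rewrite -[u]mquot_pi_repr !mquot_scale_pi scalerA. Qed.

Fact mquot_scale1r : left_id 1 mquot_scale.
Proof. by move=> u; rewrite -[u]mquot_pi_repr mquot_scale_pi scale1r. Qed.

Fact mquot_scalerDr : right_distributive mquot_scale +%R.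
Proof.
move=> a u v; rewrite -[u]mquot_pi_repr -[v]mquot_pi_repr.
by rewrite -mquot_piD !mquot_scale_pi scalerDr mquot_piD.
Qed.

Fact mquot_scalerDl (u : mquot) :
  {morph mquot_scale^~ u : a b / a + b}.
Proof.
move=> a b; rewrite -[u]mquot_pi_repr !mquot_scale_pi.
by rewrite scalerDl mquot_piD.
Qed.

HB.instance Definition _ := GRing.Zmodule_isLmodule.Build R mquot
  mquot_scalerA mquot_scale1r mquot_scalerDr mquot_scalerDl.

End QuotientModule.

Definition noetherian (R : comNzRingType) : Prop :=
  forall I : submodClosed R^o, finitely_generated I.

Fixpoint ideal_exp (R : comNzRingType) (I : {pred R}) (n : nat) : {pred R^o} :=
  if n is m.+1 then smul I (ideal_exp I m) else predT.

Definition Ass (R : comNzRingType) (L : lmodType R) : set (prime_idealr R) :=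
  [set p | exists x : L, forall r : R, (r \in p) = (r *: x == 0)].

Definition mAss (R : comNzRingType) (L : lmodType R) : set (prime_idealr R) :=
  [set p | Ass L p /\ forall q, Ass L q -> {subset q <= p} -> q =i p].

Section Topologies.
Variables (R : comNzRingType) (N : lmodType R).

(* N / I N *)
Definition mod_ideal (I : {pred R}) : lmodType R :=
  mquot (smul I (predT : {pred N})).

Definition symbolic_power (I : {pred R}) (n : nat) : set N :=
  [set x | exists2 s : R, (forall p, mAss (mod_ideal I) p -> s \notin p)
                        & s *: x \in smul (ideal_exp I n) (predT : {pred N})].

Definition symbolic_adic_equivalent (I : {pred R}) : Prop :=
  forall n : nat, exists m : nat,
    symbolic_power I m `<=` [set` smul (ideal_exp I n) (predT : {pred N})].

End Topologies.

(* Main.v *)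
Require Import Defs.
From HB Require Import structures.
From mathcomp Require Import all_boot all_algebra.
From mathcomp Require Import boolp classical_sets.

Set Implicit Arguments.
Unset Strict Implicit.
Unset Printing Implicit Defensive.

Import GRing.Theory.

Local Open Scope ring_scope.
Local Open Scope classical_set_scope.

(* If [I^n N] contains no symbolic power of [I], choose a submodule [Q] of [N]
   maximal among those containing [I^n N] but no symbolic power.  As symbolic
   powers decrease, [Q] is not the intersection of two larger submodules, so
   every zero divisor on [N / Q] is nilpotent on it.  Let [P] be an associated
   prime of [N / Q]; [P] contains the annihilator of [N / I N], hence some
   minimal associated prime [p] of [N / I N].  As the elements of [p] are
   nilpotent on [N / Q], a power [p^t N] lies in [Q], and by hypothesis it
   contains a symbolic power of [p].  This contradicts the choice of [Q], since
   a symbolic power of [p] contains the one of [I] with the same exponent. *)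

(** * Submodules as sets, spans, and the maximal condition *)

Definition submodule (R : comNzRingType) (V : lmodType R) (K : set V) :=
  K 0 /\ forall a x y, K x -> K y -> K (a *: x + y).

Section Submodules.
Variables (R : comNzRingType) (V : lmodType R).
Implicit Types (A K : set V) (x y z : V).

Lemma submoduleZ K a x : submodule K -> K x -> K (a *: x).
Proof. by case=> K0 Kl Kx; rewrite -[_ *: _]addr0; apply: Kl. Qed.

Lemma submoduleD K x y : submodule K -> K x -> K y -> K (x + y).
Proof. by case=> _ Kl Kx; rewrite -[x]scale1r; apply: Kl. Qed.

Lemma submoduleB K x y : submodule K -> K x -> K y -> K (x - y).
Proof. by case=> _ Kl Kx Ky; rewrite -scaleN1r addrC; apply: Kl. Qed.

Lemma submodClosed_submodule (S : submodClosed V) : submodule [set` S].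
Proof.
by split=> [|a x y] /=; [exact: rpred0 | move=> Sx Sy; rewrite rpredD ?rpredZ].
Qed.

(** Bridge to [noetherian], which quantifies over the bundled structure only. *)
Lemma submodule_submodClosed K :
  submodule K -> exists S : submodClosed V, forall x, (x \in S) = (x \in K).
Proof.
move=> [K0 Kl].
have Kc : GRing.submod_closed [in K].
  by split=> [|a x y]; rewrite !inE //; apply: Kl.
pose M := GRing.isSubmodClosed.Build R V [in K] Kc.
by exists (HB.pack_for (submodClosed V) ([in K] : {pred V}) M).
Qed.

Lemma mem_mspan A x : A x -> x \in mspan A.
Proof. by move=> Ax; rewrite !inE => K /= [_]; apply. Qed.

Lemma mspan_submodule A : submodule [set` mspan A].
Proof. exact: submodClosed_submodule. Qed.

Lemma mspan_min A K x : submodule K -> A `<=` K -> x \in mspan A -> K x.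
Proof.
move=> [K0 Kl] AK; rewrite !inE => /(_ K); apply; split=> //.
by split=> [|a u v]; rewrite !inE //; apply: Kl.
Qed.

Lemma mspan_cons (s : seq V) x z :
  z \in mspan [set` x :: s] -> exists a, z - a *: x \in mspan [set` s].
Proof.
pose K := [set z | exists a, z - a *: x \in mspan [set` s]].
move=> sz; apply: (@mspan_min _ K _ _ _ sz).
  split=> [|a y u] /=; first by exists 0; rewrite scale0r subr0 rpred0.
  move=> [b yb] [c uc]; exists (a * b + c).
  have -> : a *: y + u - (a * b + c) *: x = a *: (y - b *: x) + (u - c *: x).
    by rewrite scalerBr scalerA scalerDl opprD addrACA.
  by rewrite rpredD ?rpredZ.
move=> y /=; rewrite in_cons => /predU1P[->|ys].
  by exists 1; rewrite scale1r subrr rpred0.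
by exists 0; rewrite scale0r subr0; apply: mem_mspan.
Qed.

Lemma smul_min (I : {pred R}) (A : {pred V}) K x :
    submodule K -> (forall a y, a \in I -> y \in A -> K (a *: y)) ->
  x \in smul I A -> K x.
Proof.
move=> Km IAK; apply: mspan_min => // _ [a Ia [y Ay <-]]; exact: IAK.
Qed.

Lemma mem_smul (I : {pred R}) (A : {pred V}) a y :
  a \in I -> y \in A -> a *: y \in smul I A.
Proof. by move=> Ia Ay; apply: mem_mspan; exists a => //; exists y. Qed.

Lemma submodule_scale K a : submodule K -> submodule [set x | K (a *: x)].
Proof.
move=> [K0 Kl]; split=> [|b x y] /=; first by rewrite scaler0.
by rewrite scalerDr scalerA mulrC -scalerA; apply: Kl.
Qed.

Lemma submodule_annihilator K x :
  submodule K -> submodule [set a : R^o | K (a *: x)].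
Proof.
move=> [K0 Kl]; split=> [|b c d] /=; first by rewrite scale0r.
by rewrite scalerDl -scalerA; apply: Kl.
Qed.

Definition maximal_condition :=
  forall F : set (set V), F `<=` @submodule R V -> F !=set0 ->
  exists2 K, F K & forall K', F K' -> K `<=` K' -> K' `<=` K.

(** Without a maximal element, choice yields a strictly increasing chain [C] in [F]. Its union has
    finitely many generators, all of which lie in some [C n], so the chain stops there. *)
Lemma finitely_generated_maximal_condition :
    (forall K, submodule K ->
       exists2 s : seq V, [set` s] `<=` K & K `<=` [set` mspan [set` s]]) ->
  maximal_condition.
Proof.
move=> fg F Fsub [K0 FK0]; apply: contrapT => noMax.
(* The premise [F K] stands under the existential so that [choice] gives a total function. *)
have step K : exists K', F K -> [/\ F K', K `<=` K' & ~ K' `<=` K].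
  apply: contrapT => nK; apply: noMax; exists K.
    by apply: contrapT => nFK; apply: nK; exists K.
  move=> K' FK' KK'; apply: contrapT => nK'.
  by apply: nK; exists K'.
have [f fP] := choice step.
pose C n := iter n f K0.
have FC n : F (C n) by elim: n => //= n IH; have [] := fP _ IH.
have mono m n : (m <= n)%N -> C m `<=` C n.
  move=> /subnK <-; elim: (n - m)%N => //= k IH; apply: subset_trans IH _.
  by have [] := fP _ (FC (k + m)%N).
have Um : submodule (\bigcup_n C n).
  split=> [|a x y [m _ Cx] [n _ Cy]]; first by exists 0%N; case: (Fsub _ FK0).
  exists (maxn m n) => //; have [_] := Fsub _ (FC (maxn m n)); apply.
    exact: mono (leq_maxl _ _) _ Cx.
  exact: mono (leq_maxr _ _) _ Cy.
have [s sU Us] := fg _ Um.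
have [n sC] : exists n, [set` s] `<=` C n.
  elim: s sU {Us} => [|x s IH] sU; first by exists 0%N.
  have [|n sC] := IH.
    by move=> y ys; apply: sU; rewrite /= in_cons [y \in s]ys orbT.
  have [|m _ Cx] := sU x; first by rewrite /= mem_head.
  exists (maxn m n) => y /=; rewrite in_cons => /predU1P[->|ys].
    exact: mono (leq_maxl _ _) _ Cx.
  exact: mono (leq_maxr _ _) _ (sC _ ys).
have [_ _ []] := fP _ (FC n); move=> x fx.
by apply: mspan_min (Fsub _ (FC n)) sC _; apply: Us; exists n.+1.
Qed.

End Submodules.

(** * Finitely generated modules over a Noetherian ring *)

Section Noetherian.
Variables (R : comNzRingType) (V : lmodType R).
Hypothesis Rnoeth : noetherian R.

Lemma ideal_finitely_generated (J : set R^o) :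
    submodule J ->
  exists2 s : seq R^o, [set` s] `<=` J & J `<=` [set` mspan [set` s]].
Proof.
move=> /submodule_submodClosed[S SJ].
have [s sS] := Rnoeth S; exists s => a /= ?; last by rewrite sS SJ mem_set.
by apply: set_mem; rewrite -SJ -sS mem_mspan.
Qed.

Lemma noetherian_ring_maximal_condition : maximal_condition R^o.
Proof.
exact: finitely_generated_maximal_condition ideal_finitely_generated.
Qed.

(** Induction on [s]. The coefficients of [x] in elements of [K], taken modulo the span of [s], form
    an ideal with generators [c]. Lifts of [c] to [K], together with generators [t] of the part of
    [K] inside the span of [s], generate [K]. *)
Lemma sub_mspan_finitely_generated (s : seq V) (K : set V) :
    submodule K -> K `<=` [set` mspan [set` s]] ->
  exists2 t : seq V, [set` t] `<=` K & K `<=` [set` mspan [set` t]].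
Proof.
elim: s K => [|x s IH] K Km Ks; first by exists [::].
have Ss := mspan_submodule [set` s].
have [|y []//|t tKs Kst] := IH (K `&` [set` mspan [set` s]]).
  split=> [|a y z [Ky sy] [Kz sz]]; first by split; [case: Km | case: Ss].
  by split; [apply: Km.2 | apply: Ss.2].
pose lead a k := K k /\ k - a *: x \in mspan [set` s].
have [|c cJ Jc] := @ideal_finitely_generated [set a | exists k, lead a k].
  split=> [|a b1 b2 [k1 [K1 s1]] [k2 [K2 s2]]].
    by exists 0; split; [case: Km | rewrite scale0r subr0 rpred0].
  exists (a *: k1 + k2); split; first exact: Km.2.
  have -> : a *: k1 + k2 - (a *: b1 + b2) *: x
          = a *: (k1 - b1 *: x) + (k2 - b2 *: x).
    by rewrite scalerBr scalerA scalerDl opprD addrACA.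
  by rewrite rpredD ?rpredZ.
have [f fP] : {f : R -> V & forall a, a \in c -> lead a (f a)}.
  apply: (@choice _ _ (fun a k => a \in c -> lead a k)) => a.
  by have [/cJ[k ak]|] := boolP (a \in c); [exists k | exists 0].
pose u := map f c ++ t.
have uK : [set` u] `<=` K.
  move=> y; rewrite /= mem_cat => /orP[/mapP[a /fP[Kf _] ->]//|/tKs[]//].
have spanuK y : y \in mspan [set` u] -> K y by exact: mspan_min.
have fu y : y \in mspan [set` map f c] -> y \in mspan [set` u].
  apply: (mspan_min (mspan_submodule _)) => z /= fz; apply: mem_mspan.
  by rewrite /= mem_cat fz.
have tu y : y \in mspan [set` t] -> y \in mspan [set` u].
  apply: (mspan_min (mspan_submodule _)) => z /= tz; apply: mem_mspan.
  by rewrite /= mem_cat tz orbT.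
exists u => // y Ky /=.
have [a ya] := mspan_cons (Ks _ Ky).
(* [w] has the same coefficient [a] of [x] as [y], so that [y - w] falls into the part generated by
   [t]. *)
have [w uw wa] : exists2 w, w \in mspan [set` u]
                          & w - a *: x \in mspan [set` s].
  pose J := [set a : R^o | exists2 w, w \in mspan [set` u]
                                    & w - a *: x \in mspan [set` s]].
  suff: J a by [].
  apply: (@mspan_min _ _ [set` c]); last by apply: Jc; exists y.
    split=> [|b b1 b2 [w1 u1 s1] [w2 u2 s2]].
      by exists 0; rewrite ?scale0r ?subr0 rpred0.
    exists (b *: w1 + w2); first by rewrite rpredD ?rpredZ.
    have -> : b *: w1 + w2 - (b *: b1 + b2) *: x
            = b *: (w1 - b1 *: x) + (w2 - b2 *: x).
      by rewrite scalerBr scalerA scalerDl opprD addrACA.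
    by rewrite rpredD ?rpredZ.
  move=> b cb; have [Kf sf] := fP _ cb; exists (f b) => //.
  by apply/fu/mem_mspan/map_f.
rewrite -[y](subrK w) rpredD //; apply/tu/Kst; split.
  by apply: submoduleB => //; apply: spanuK.
have -> : y - w = (y - a *: x) - (w - a *: x) by rewrite opprB addrA subrK.
exact: (submoduleB Ss ya wa).
Qed.

Lemma noetherian_module_maximal_condition :
  finitely_generated (predT : {pred V}) -> maximal_condition V.
Proof.
move=> [s sT]; apply: finitely_generated_maximal_condition => K Km.
by apply: (@sub_mspan_finitely_generated s) => // x _; rewrite /= sT.
Qed.

End Noetherian.

(** * Powers of an ideal and their products with a module *)

Section IdealPowers.
Variables (R : comNzRingType) (I : {pred R}).

Lemma ideal_exp_submodule n : submodule [set` ideal_exp I n].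
Proof. by case: n => [|n] //; apply: mspan_submodule. Qed.

Lemma ideal_exp_sub_ideal (J : {pred R}) n :
  {subset I <= J} -> {subset ideal_exp I n <= ideal_exp J n}.
Proof.
move=> IJ; elim: n => // n IH c.
apply: (smul_min (mspan_submodule _)) => a b Ia Ib.
by apply: mem_smul; [apply: IJ | apply: IH].
Qed.

Lemma ideal_exp_decr m n :
  (m <= n)%N -> {subset ideal_exp I n <= ideal_exp I m}.
Proof.
move=> /subnK <-; elim: (n - m)%N => // k IH c.
apply: (smul_min (ideal_exp_submodule m)) => a b _ /IH.
exact: submoduleZ (ideal_exp_submodule m).
Qed.

Variable V : lmodType R.

Lemma smul_sub (J : {pred R}) :
    {subset I <= J} ->
  {subset smul I (predT : {pred V}) <= smul J (predT : {pred V})}.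
Proof.
move=> IJ x; apply: (smul_min (mspan_submodule _)) => a y Ia _.
by apply: mem_smul => //; apply: IJ.
Qed.

Lemma expr_scale_smul (s : R) :
    (forall x : V, s *: x \in smul I (predT : {pred V})) ->
  forall n (x : V), s ^+ n *: x \in smul (ideal_exp I n) (predT : {pred V}).
Proof.
move=> sI n; elim: n => [|n IH] x; first exact: mem_smul.
have Tm := @mspan_submodule.
rewrite exprSr -scalerA.
apply: (smul_min (submodule_scale _ (Tm _ _ _)) _ (sI x)).
move=> a y Ia _ /=; rewrite scalerA mulrC -scalerA.
apply: (smul_min (submodule_scale _ (Tm _ _ _)) _ (IH y)) => b z Ib _ /=.
by rewrite scalerA; apply: mem_smul => //; apply: (mem_smul (V := R^o)).
Qed.

End IdealPowers.

(** * Saturations, associated primes and colon submodules *)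

Section AssociatedPrimes.
Variables (R : comNzRingType) (V : lmodType R).
Implicit Types (K Q : set V) (p P : prime_idealr R) (x y z : V).

Lemma submodule_prime_idealr (J : set R^o) :
    submodule J -> ~ J 1 -> (forall a b, J (a * b) -> J a \/ J b) ->
  exists p : prime_idealr R, forall a, (a \in p) <-> J a.
Proof.
move=> Jm J1 JM; pose q : {pred R} := [pred a | `[< J a >]].
have qE a : (a \in q) = `[< J a >] by rewrite inE.
have qid : idealr_closed q.
  split; rewrite ?qE; [exact/asboolP/Jm.1 | exact/asboolP | move=> a u v].
  by rewrite !qE => /asboolP Ju /asboolP Jv; apply/asboolP/Jm.2.
have qpr : prime_idealr_closed q.
  by move=> u v; rewrite !qE => /asboolP/JM[]/asboolP->; rewrite ?orbT.
pose Mi := isIdealr.Build R q qid.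
pose Mp := isPrimeIdealrClosed.Build R q qpr.
exists (HB.pack_for (prime_idealr R) q Mi Mp) => a.
by rewrite [_ \in _]qE; split=> /asboolP.
Qed.

Lemma prime_idealrX p a n : a ^+ n \in p -> a \in p.
Proof.
elim: n => [|n IH]; first by rewrite expr0 idealr1.
by rewrite exprS prime_idealrM => /orP[].
Qed.

Lemma prime_idealr_notinM p a b : a \notin p -> b \notin p -> a * b \notin p.
Proof. by move=> pa pb; rewrite prime_idealrM negb_or pa. Qed.

(** For a submodule [K] and a multiplicative set [S], this is the kernel of the map from [V] to the
    localization of [V / K] at [S]; it replaces localized modules throughout. *)
Definition saturation (S : set R) K : set V :=
  [set x | exists2 s, S s & K (s *: x)].

Definition compl p : set R := [set s | s \notin p].

Lemma saturation_compl_submodule p K :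
  submodule K -> submodule (saturation (compl p) K).
Proof.
move=> Km; split=> [|a x y [s ps Kx] [t pt Ky]].
  by exists 1; rewrite ?scaler0; [rewrite /compl /= idealr1 | case: Km].
exists (s * t); first exact: prime_idealr_notinM.
have -> : (s * t) *: (a *: x + y) = (t * a) *: (s *: x) + s *: (t *: y).
  by rewrite scalerDr !scalerA [in RHS]mulrC mulrA.
by apply: Km.2 => //; apply: submoduleZ.
Qed.

Lemma sub_saturation_compl p K : K `<=` saturation (compl p) K.
Proof. by move=> x Kx; exists 1; rewrite ?scale1r// /compl /= idealr1. Qed.

(* Any maximal element among the annihilators of the elements of [V / K] that
   survive in the localization at [S] is prime. *)
Lemma prime_annihilator (S : set R) K x :
    noetherian R -> S 1 -> (forall a b, S a -> S b -> S (a * b)) ->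
    submodule K -> ~ saturation S K x ->
  exists p, exists2 y, ~ saturation S K y & forall a, (a \in p) <-> K (a *: y).
Proof.
move=> Rn S1 SM Km Sx; pose ann y : set R^o := [set a | K (a *: y)].
have annm y : submodule (ann y) by apply: submodule_annihilator.
have [] := noetherian_ring_maximal_condition Rn
    (F := [set J | exists2 y, ~ saturation S K y & J = ann y]).
- by move=> _ [y _ ->].
- by exists (ann x), x.
move=> _ [y Sy ->] ymax.
have max b : ~ saturation S K (b *: y) -> ann (b *: y) `<=` ann y.
  move=> Sby; apply: ymax; first by exists (b *: y).
  by move=> a ay; rewrite /ann /= scalerA mulrC -scalerA; apply: submoduleZ.
have [|||p pE] := @submodule_prime_idealr (ann y) => //.
- by rewrite /ann /= scale1r => Ky; apply: Sy; exists 1; rewrite ?scale1r.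
- move=> a b; rewrite /ann /= -scalerA => Kaby.
  (* If [b *: y] survives, its annihilator, which contains [a], lies in that of [y]. Otherwise some
     [s] in [S] kills it; then [s *: y] survives and [b] annihilates it. *)
  have [[s Ss Ksby]|/max mb] := pselect (saturation S K (b *: y)).
    right; apply: (max s); last by rewrite /ann /= scalerA mulrC -scalerA.
    move=> [t St Kty]; apply: Sy; exists (t * s); first exact: SM.
    by rewrite -scalerA.
  by left; apply: mb.
by exists p, y.
Qed.

(** An element of [p] outside [P] would be a denominator putting [y] into the saturation. *)
Lemma prime_annihilator_compl P K x :
    noetherian R -> submodule K -> ~ saturation (compl P) K x ->
  exists p, exists2 y, ~ saturation (compl P) K y
    & (forall a, (a \in p) <-> K (a *: y)) /\ {subset p <= P}.
Proof.
move=> Rn Km Px; have [||p [y Py pE]] := prime_annihilator Rn _ _ Km Px.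
- by rewrite /compl /= idealr1.
- by move=> a b; apply: prime_idealr_notinM.
exists p, y => //; split=> // a pa.
by apply: contrapT => /negP Pa; apply: Py; exists a => //; apply/pE.
Qed.

Lemma prime_annihilator1 K x :
    noetherian R -> submodule K -> ~ K x ->
  exists p, exists2 y, ~ K y & forall a, (a \in p) <-> K (a *: y).
Proof.
have sat1 y : K y -> saturation [set 1] K y by exists 1; rewrite ?scale1r.
have sat1V y : saturation [set 1] K y -> K y.
  by case=> _ ->; rewrite scale1r.
move=> Rn Km Kx; have nKx : ~ saturation [set 1] K x by move/sat1V.
have [//|_ _ -> ->|p [y Ky pE]] := prime_annihilator Rn _ _ Km nKx.
  by rewrite mulr1.
by exists p, y => // /sat1.
Qed.

(** The product of the denominators of the generators serves for all elements. *)
Lemma sub_saturation_finitely_generated p K :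
    finitely_generated (predT : {pred V}) -> submodule K ->
    (forall x, saturation (compl p) K x) ->
  exists2 s, s \notin p & forall x, K (s *: x).
Proof.
move=> [g gT] Km satT.
have [s ps sg] : exists2 s, s \notin p & forall x, x \in g -> K (s *: x).
  elim: g {gT} => [|x g [s ps sg]]; first by exists 1; rewrite ?idealr1.
  have [t pt tx] := satT x; exists (t * s); first exact: prime_idealr_notinM.
  move=> y; rewrite in_cons -scalerA => /predU1P[->|/sg];
    last exact: submoduleZ.
  by rewrite scalerA mulrC -scalerA; apply: submoduleZ.
exists s => // x; suff: [set x | K (s *: x)] x by [].
apply: (mspan_min (A := [set` g]) (submodule_scale s Km)); first exact: sg.
by rewrite gT.
Qed.

Lemma AssP (K : submodClosed V) p :
  Ass (mquot K) p <-> exists x, forall a, (a \in p) <-> a *: x \in K.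
Proof.
split=> [[u pE]|[x pE]].
  exists (repr u) => a; rewrite pE.
  have -> : a *: u = mquot_pi K (a *: repr u).
    by rewrite -mquot_scale_pi mquot_pi_repr.
  by rewrite mquot_pi_eq0.
exists (mquot_pi K x) => a; rewrite -[_ *: _]/(mquot_scale a _).
by rewrite mquot_scale_pi mquot_pi_eq0; apply/idP/idP => /pE.
Qed.

(* Among the primes [q <= P] containing the annihilator of [V / K], take one
   whose saturation of [K] is maximal: this replaces the descending chain
   condition on primes in the proof of minimality. *)
Lemma exists_mAss_sub (K : submodClosed V) P :
    noetherian R -> finitely_generated (predT : {pred V}) ->
    (forall s, (forall x, s *: x \in K) -> s \in P) ->
  exists2 p, mAss (mquot K) p & {subset p <= P}.
Proof.
move=> Rn Vfg AnnP; have Km := submodClosed_submodule K.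
pose F := [set M | exists q : prime_idealr R,
  [/\ forall s, (forall x, s *: x \in K) -> s \in q, {subset q <= P}
    & M = saturation (compl q) [set` K]]].
have [] := noetherian_module_maximal_condition Rn Vfg (F := F).
- by move=> _ [q [_ _ ->]]; apply: saturation_compl_submodule.
- by exists (saturation (compl P) [set` K]), P; split.
move=> _ [P0 [AnnP0 P0P ->]] P0max.
have [x0 x0P] : exists x, ~ saturation (compl P0) [set` K] x.
  apply: contrapT => /forallNP satT.
  have [|s sP0 sK] := sub_saturation_finitely_generated Vfg Km (p := P0).
    by move=> x; apply: contrapT; apply: satT.
  by move: sP0; rewrite AnnP0.
have [p [y yP0 [pE pP0]]] := prime_annihilator_compl Rn Km x0P.
exists p; last by move=> a /pP0/P0P.
split=> [|q /AssP[x qE] qp]; first by apply/AssP; exists y.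
(* As [q] lies in [P0], saturating at [q] gives at least as much, hence by maximality the same. An
   [a] in [p] outside [q] would then place [y] in the saturation at [P0]. *)
have sat_q : saturation (compl q) [set` K] `<=` saturation (compl P0) [set` K].
  apply: P0max; last first.
    by move=> z [s sP0 sz]; exists s => //; apply: contra sP0 => /qp/pP0.
  exists q; split=> // [s sK|a /qp/pP0/P0P//]; exact/qE/sK.
move=> a; apply/idP/idP=> [/qp//|pa]; apply: contrapT => /negP qa.
by apply: yP0; apply: sat_q; exists a => //; apply/pE.
Qed.

(* A maximal proper [p]-saturated submodule contains [p V]: this is Nakayama's
   lemma for the localization of [V] at [p]. *)
Lemma saturation_smul_proper p K x :
    maximal_condition V -> submodule K -> ~ saturation (compl p) K x ->
  exists y, ~ saturation (compl p) [set` smul p (predT : {pred V})] y.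
Proof.
move=> Vn Km Kx.
pose F := [set M | [/\ submodule M, saturation (compl p) M `<=` M
                     & exists x, ~ M x]].
have satK M : saturation (compl p) (saturation (compl p) M)
    `<=` saturation (compl p) M.
  move=> z [s ps [t pt Mz]]; exists (t * s); first exact: prime_idealr_notinM.
  by rewrite -scalerA.
have [] := Vn F; first by move=> M [].
  exists (saturation (compl p) K); split; last by exists x.
    exact: saturation_compl_submodule.
  exact: satK.
move=> M [Mm Msat [y My]] Mmax; exists y => -[s ps sy]; apply: My.
apply: (Msat); exists s => //; apply: smul_min sy => // a z pa _.
apply: contrapT => Maz.
(* [L] is [M] enlarged by the multiples of [a *: z]; its saturation exceeds [M], hence is everything
   and contains [z]. *)
pose L := [set w | exists r, M (w - r *: (a *: z))].
have Lm : submodule L.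
  split=> [|b u v [r Mu] [t Mv]].
    by exists 0; rewrite scale0r subr0; case: Mm.
  exists (b * r + t); rewrite scalerDl -scalerA opprD addrACA -scalerBr.
  exact: Mm.2.
have ML : M `<=` L by move=> w Mw; exists 0; rewrite scale0r subr0.
have [c pc [r Mcz]] : saturation (compl p) L z.
  apply: contrapT => nLz; apply: Maz; apply: (Mmax (saturation (compl p) L)).
  - by split; [exact: saturation_compl_submodule | exact: satK | exists z].
  - by move=> w /ML; apply: sub_saturation_compl.
  apply: sub_saturation_compl.
  by exists 1; rewrite scale1r subrr; case: Mm.
apply: Maz; apply: submoduleZ => //; apply: Msat.
(* This denominator avoids [p] because [c] does and [a] lies in [p]. *)
exists (c - r * a); last by rewrite scalerBl -scalerA.
apply: contra pc => pcra; rewrite -[c](subrK (r * a)) rpredD // prime_idealrM.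
by rewrite pa orbT.
Qed.

(** The colons of [Q] by powers of [a] stabilize. If [x] is [a ^+ t *: z] modulo [Q] and [a ^+ t]
    kills [x], then [a ^+ (t + t)] kills [z] modulo [Q], hence so does [a ^+ t] by stability. *)
Lemma colon_expr_stable Q a :
    maximal_condition V -> submodule Q ->
  exists2 t, (0 < t)%N
    & forall x z, Q (x - a ^+ t *: z) -> Q (a ^+ t *: x) -> Q x.
Proof.
move=> Vn Qm; pose C t := [set x | Q (a ^+ t *: x)].
have CS t k : C t `<=` C (k + t)%N.
  by move=> x Cx; rewrite /C /= exprD -scalerA; apply: submoduleZ.
have [] := Vn [set C t | t in setT].
- by move=> _ [t _ <-]; apply: submodule_scale.
- by exists (C 0%N), 0%N.
(* The successor makes the exponent positive, so that whatever [a] kills modulo [Q] is killed by the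
   chosen power. *)
move=> _ [t _ <-] tmax; exists t.+1 => // x z Qxz Qx.
have Cz : C (t.+1 + t.+1)%N z.
  have -> : C (t.+1 + t.+1)%N z
          = Q (a ^+ t.+1 *: x - a ^+ t.+1 *: (x - a ^+ t.+1 *: z)).
    by rewrite /C /= exprD -scalerA scalerBr subKr.
  by apply: submoduleB => //; apply: submoduleZ.
have Ctz : C t z.
  apply: (tmax (C (t.+1 + t.+1)%N)) Cz; first by exists (t.+1 + t.+1)%N.
  by rewrite addnS -addSn; apply: CS.
rewrite -[x](subrK (a ^+ t.+1 *: z)); apply: submoduleD => //.
by rewrite exprS -scalerA; apply: submoduleZ.
Qed.

(** The colons [C t] of [Q] by powers of [p] stabilize. If the stable one is proper, its quotient
    has an associated prime, which contains [p] by nilpotency; the element [y] it annihilates then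
    lies in [C t.+1], a contradiction. *)
Lemma ideal_exp_colon p Q :
    noetherian R -> maximal_condition V -> submodule Q ->
    (forall a, a \in p -> exists t, forall x, Q (a ^+ t *: x)) ->
  exists t, forall c x, c \in ideal_exp p t -> Q (c *: x).
Proof.
move=> Rn Vn Qm pnil.
pose C t := [set x | forall c, c \in ideal_exp p t -> Q (c *: x)].
have Cm t : submodule (C t).
  split=> [c _|b x y Cx Cy c pc]; first by rewrite scaler0; case: Qm.
  rewrite scalerDr scalerA mulrC -scalerA.
  by apply: Qm.2; [apply: Cx | apply: Cy].
have CS t x : (forall a, a \in p -> C t (a *: x)) -> C t.+1 x.
  move=> Cx c; apply: (smul_min (submodule_annihilator x Qm)).
  by move=> a b pa pb /=; rewrite -[a *: b]mulrC -scalerA; apply: Cx.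
have [] := Vn [set C t | t in setT]; first by move=> _ [t _ <-]; apply: Cm.
  by exists (C 0%N), 0%N.
move=> _ [t _ <-] tmax; exists t => c x; move: c; rewrite -/(C t x).
apply: contrapT => /(prime_annihilator1 Rn (Cm t))[p' [y Cy p'E]].
apply: Cy; apply: (tmax (C t.+1)); first by exists t.+1.
  by move=> z Cz; apply: CS => a _; apply: submoduleZ (Cm t) Cz.
apply: CS => a pa; have [e ea] := pnil a pa.
apply/p'E/(@prime_idealrX _ _ e)/p'E => c pc; apply: submoduleZ Qm (ea _).
Qed.

End AssociatedPrimes.

(** * Symbolic powers of an ideal and of its minimal primes *)

Section SymbolicPowers.
Variables (R : comNzRingType) (N : lmodType R).

Lemma symbolic_power_decr (I : {pred R}) m n :
  (m <= n)%N -> @symbolic_power _ N I n `<=` @symbolic_power _ N I m.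
Proof.
move=> mn x [s sI sx]; exists s => //; apply: smul_sub sx.
exact: ideal_exp_decr.
Qed.

Lemma Ass_mod_ideal_sub (I : {pred R}) (p : prime_idealr R) :
  Ass (mod_ideal N I) p -> {subset I <= p}.
Proof. by move=> /AssP[x pE] a Ia; apply/pE/mem_smul. Qed.

(** Since [x] survives localization at [p], Nakayama's lemma makes the localization of [N / p N]
    non-zero. This gives an associated prime of [N / p N] inside [p], and it contains [p]. *)
Lemma Ass_mod_ideal_self (I : {pred R}) (p : prime_idealr R) :
    noetherian R -> maximal_condition N -> Ass (mod_ideal N I) p ->
  Ass (mod_ideal N p) p.
Proof.
move=> Rn Nn /AssP[x pE]; have spanm := @mspan_submodule R N.
have px : ~ saturation (compl p) [set` smul I (predT : {pred N})] x.
  by move=> [s sp sx]; move: sp; rewrite /compl /= (pE s).2.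
have [y py] := saturation_smul_proper Nn (spanm _) px.
have [q [z _ [qE qp]]] := prime_annihilator_compl Rn (spanm _) py.
apply/AssP; exists z => a; split=> [pa|az]; first exact: mem_smul.
exact/qp/qE.
Qed.

(** The only minimal associated prime of [N / p N] is [p] itself, so a denominator allowed for [I]
    is allowed for [p]. *)
Lemma symbolic_power_sub_mAss (I : {pred R}) (p : prime_idealr R) n :
    noetherian R -> maximal_condition N -> mAss (mod_ideal N I) p ->
  @symbolic_power _ N I n `<=` @symbolic_power _ N p n.
Proof.
move=> Rn Nn pI x [s sI sx]; have Ip := Ass_mod_ideal_sub pI.1.
exists s; last exact: smul_sub (ideal_exp_sub_ideal Ip) _ sx.
move=> q [pq qmin]; rewrite -(qmin p); first exact: sI.
  exact: Ass_mod_ideal_self pI.1.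
exact: Ass_mod_ideal_sub pq.
Qed.

End SymbolicPowers.

Theorem theorem2p5 (R : comNzRingType) (N : lmodType R) (I : submodClosed R^o) :
  noetherian R ->
  (exists x : N, x != 0) ->
  finitely_generated (predT : {pred N}) ->
  (exists u : mod_ideal N I, u != 0) ->
  (forall p : prime_idealr R,
     mAss (mod_ideal N I) p -> symbolic_adic_equivalent N p) ->
  symbolic_adic_equivalent N I.
Proof.
move=> Rn _ Nfg _ sym n; have Nn := noetherian_module_maximal_condition Rn Nfg.
apply: contrapT => bad; set T := smul _ _ in bad.
pose F := [set Q | [/\ submodule Q, [set` T] `<=` Q
                     & ~ exists m, @symbolic_power _ N I m `<=` Q]].
have [] := Nn F; first by move=> Q [].
  by exists [set` T]; split=> //; apply: mspan_submodule.
move=> Q [Qm TQ Qbad] Qmax.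
(* Maximality of [Q], with [x] witnessing that [Q'] is strictly larger. *)
have good Q' x : submodule Q' -> Q `<=` Q' -> Q' x -> ~ Q x ->
    exists m, @symbolic_power _ N I m `<=` Q'.
  move=> Qm' QQ' Qx' Qx; apply: contrapT => Qbad'.
  apply/Qx/(Qmax Q') => //; split=> //.
  exact: subset_trans QQ'.
(* As [Q = (Q : a^t) :&: (Q + a^t N)] for some [t > 0], one of the two must be
   [Q] itself by maximality. *)
have nil a y : ~ Q y -> Q (a *: y) -> exists t, forall x, Q (a ^+ t *: x).
  move=> Qy Qay; have [t t0 tP] := colon_expr_stable a Nn Qm.
  exists t => x; apply: contrapT => Qx.
  have [||||m1 m1P] := good [set z | Q (a ^+ t *: z)] y => //.
  - exact: submodule_scale.
  - by move=> z; apply: submoduleZ.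
  - case: t t0 {tP Qx} => // t _ /=.
    by rewrite exprSr -scalerA; apply: submoduleZ.
  have [||||m2 m2P] :=
      good [set z | exists w, Q (z - a ^+ t *: w)] (a ^+ t *: x) => //.
  - split=> [|b z1 z2 [w1 Q1] [w2 Q2]].
      by exists 0; rewrite scaler0 subr0; case: Qm.
    exists (b *: w1 + w2); rewrite scalerDr scalerA [_ * b]mulrC -scalerA.
    by rewrite opprD addrACA -scalerBr; apply: Qm.2.
  - by move=> z Qz; exists 0; rewrite scaler0 subr0.
  - by exists x; rewrite subrr; case: Qm.
  apply: Qbad; exists (maxn m1 m2) => z sz.
  have [w Qzw] := m2P _ (symbolic_power_decr (leq_maxr _ _) sz).
  exact: tP Qzw (m1P _ (symbolic_power_decr (leq_maxl _ _) sz)).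
have [x Qx] : exists x, ~ Q x.
  by apply: contrapT => /forallNP QT; apply: Qbad; exists 0%N => x _;
    apply: contrapT.
have [P [y Qy PE]] := prime_annihilator1 Rn Qm Qx.
have [p pI pP] : exists2 p, mAss (mod_ideal N I) p & {subset p <= P}.
  apply: exists_mAss_sub => // s sI.
  (* If [s] kills [N / I N], then [s ^+ n] maps [N] into [T], hence into [Q], so it lies in the
     prime [P]. *)
  by apply/(@prime_idealrX _ _ _ n)/PE/TQ/expr_scale_smul.
(* Elements of [p] lie in [P], so they kill [y] modulo [Q] and are nilpotent on [N / Q]. *)
have [a /pP/PE/nil|t tQ] := ideal_exp_colon Rn Nn Qm (p := p); first exact.
have [m mP] := sym p pI t; apply: Qbad; exists m => z sz.
apply: smul_min (mP _ (symbolic_power_sub_mAss Rn Nn pI sz)) => // c w pc _.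
exact: tQ.
Qed.
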